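(* The contravariant functor $F$ from the category $\mathsf{Stfd}$ of stratifolds to the category of $\mathbb{R}$-algebras, defined by $F(S,\mathcal{C})=\mathcal{C}$ on objects and $F(\varphi)=\varphi^*$, $\varphi^*(g)=g\circ\varphi$, on morphisms, is fully faithful; that is, for all stratifolds $(S,\mathcal{C})$ and $(S',\mathcal{C}')$ the induced map $$F:\mathrm{Hom}_{\mathsf{Stfd}}((S,\mathcal{C}),(S',\mathcal{C}'))\to \mathrm{Hom}_{\mathbb{R}\text{-}\mathsf{Alg}}(\mathcal{C}',\mathcal{C})$$ is a bijection. Thus the category of stratifolds fully faithfully embeds into the category of $\mathbb{R}$-algebras.
   Context: A differential space is a pair $(S,\mathcal{C})$ of a topological space $S$ and an $\mathbb{R}$-subalgebra $\mathcal{C}$ of the algebra $C^0(S)$ of continuous real-valued functions on $S$ which is locally detectable ($f\in\mathcal{C}$ if and only if for every $x\in S$ there are an open neighborhood $U$ of $x$ and $g\in\mathcal{C}$ with $f|_U=g|_U$) and $C^\infty$-closed (for all $n\ge 1$, $f_1,\dots,f_n\in\mathcal{C}$ and smooth $g:\mathbb{R}^n\to\mathbb{R}$, the function $x\mapsto g(f_1(x),\dots,f_n(x))$ is in $\mathcal{C}$). A morphism of differential spaces $f:(S,\mathcal{C})\to(S',\mathcal{C}')$ is a continuous map $f:S\to S'$ with $\varphi\circ f\in\mathcal{C}$ for all $\varphi\in\mathcal{C}'$. For $x\in S$, $\mathcal{C}_x$ is the algebra of germs at $x$ of elements of $\mathcal{C}$ and the tangent space $T_xS$ is the vector space of derivations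 of $\mathcal{C}_x$ (at $x$, i.e. into $\mathbb{R}$ via evaluation at $x$). A stratifold is a differential space $(S,\mathcal{C})$ such that: (1) $S$ is locally compact Hausdorff with countable basis; (2) the skeleta $sk_k(S)=\{x\in S\mid \dim T_xS\le k\}$ are closed in $S$; (3) for each $x\in S$ and open neighborhood $U$ of $x$ there is a non-negative $\rho\in\mathcal{C}$ with $\rho(x)\ne0$ and $\mathrm{supp}\,\rho\subset U$; (4) the strata $S^k:=sk_k(S)-sk_{k-1}(S)$ are $k$-dimensional smooth manifolds such that restriction along $S^k\hookrightarrow S$ induces an isomorphism $\mathcal{C}_x\to C^\infty(S^k)_x$ for each $x\in S^k$. All stratifolds are assumed finite-dimensional: $S=sk_n(S)$ for some $n\ge 0$. The category $\mathsf{Stfd}$ is the full subcategory of the category of differential spaces spanned by the stratifolds. Morphisms of $\mathbb{R}$-algebras preserve the unit. *)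

(* Defs.v *)
From HB Require Import structures.
From mathcomp Require Import all_boot all_order all_algebra.
From mathcomp Require Import generic_quotient.
From mathcomp Require Import boolp classical_sets functions cardinality reals.
From mathcomp Require Import topology normedtype derive.

Set Implicit Arguments.
Unset Strict Implicit.
Unset Printing Implicit Defensive.

Import Order.TTheory GRing.Theory Num.Theory.
Import numFieldNormedType.Exports.

Local Open Scope classical_set_scope.
Local Open Scope ring_scope.
Local Open Scope quotient_scope.

Record category := Category {
  obj :> Type;
  hom : obj -> obj -> Type;
  idm : forall X, hom X X;
  comp : forall X Y Z, hom Y Z -> hom X Y -> hom X Z;
  comp_idl : forall X Y (f : hom X Y), comp (idm Y) f = f;
  comp_idr : forall X Y (f : hom X Y), comp f (idm X) = f;
  comp_assoc : forall W X Y Z (h : hom Y Z) (g : hom X Y) (f : hom W X),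
    comp h (comp g f) = comp (comp h g) f
}.
Arguments hom {c} _ _.
Arguments idm {c} X.
Arguments comp {c X Y Z} _ _.

Definition full_subcategory (C : category) (P : C -> Prop) : category :=
  @Category {X : C | P X} (fun X Y => hom (sval X) (sval Y))
    (fun X => idm (sval X)) (fun X Y Z => @comp C (sval X) (sval Y) (sval Z))
    (fun X Y => @comp_idl C (sval X) (sval Y))
    (fun X Y => @comp_idr C (sval X) (sval Y))
    (fun W X Y Z => @comp_assoc C (sval W) (sval X) (sval Y) (sval Z)).

Record contra_functor (C D : category) := ContraFunctor {
  fobj :> C -> D;
  fmap : forall X Y, hom X Y -> hom (fobj Y) (fobj X);
  fmap_id : forall X, fmap (idm X) = idm (fobj X);
  fmap_comp : forall X Y Z (g : hom Y Z) (f : hom X Y),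
    fmap (comp g f) = comp (fmap f) (fmap g)
}.

Definition fully_faithful (C D : category) (F : contra_functor C D) : Prop :=
  forall X Y : C, bijective (@fmap C D F X Y).

(* Unital associative algebras.  MathComp's [algType R] excludes the zero
   algebra, which is the algebra of functions on the empty space. *)
Record algebra (R : pzRingType) := Algebra {
  alg_ring :> pzRingType;
  alg_scale : R -> alg_ring -> alg_ring;
  alg_scaleA : forall a b x, alg_scale a (alg_scale b x) = alg_scale (a * b) x;
  alg_scale1 : forall x, alg_scale 1 x = x;
  alg_scaleDr : forall a x y, alg_scale a (x + y) = alg_scale a x + alg_scale a y;
  alg_scaleDl : forall a b x, alg_scale (a + b) x = alg_scale a x + alg_scale b x;
  alg_scaleMl : forall a x y, alg_scale a (x * y) = alg_scale a x * y;
  alg_scaleMr : forall a x y, alg_scale a (x * y) = x * alg_scale a y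
}.

Section AlgebraCategory.
Variable R : pzRingType.

Record alg_hom (A B : algebra R) := AlgHom {
  alg_hom_fun :> A -> B;
  alg_homD : {morph alg_hom_fun : x y / x + y};
  alg_homM : {morph alg_hom_fun : x y / x * y};
  alg_hom1 : alg_hom_fun 1 = 1;
  alg_homZ : forall a x, alg_hom_fun (alg_scale a x) = alg_scale a (alg_hom_fun x)
}.

Lemma alg_hom_eq (A B : algebra R) (f g : alg_hom A B) : f =1 g -> f = g.
Proof.
case: f => f fD fM f1 fZ; case: g => g gD gM g1 gZ /= /funext efg.
case: g / efg in gD gM g1 gZ *.
by congr AlgHom; exact: Prop_irrelevance.
Qed.

Definition alg_id (A : algebra R) : alg_hom A A :=
  @AlgHom A A id (fun _ _ => erefl) (fun _ _ => erefl) erefl (fun _ _ => erefl).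

Program Definition alg_comp (A B C : algebra R) (g : alg_hom B C)
  (f : alg_hom A B) : alg_hom A C := @AlgHom A C (g \o f) _ _ _ _.
Next Obligation. by move=> A B C g f x y /=; rewrite !alg_homD. Qed.
Next Obligation. by move=> A B C g f x y /=; rewrite !alg_homM. Qed.
Next Obligation. by move=> A B C g f /=; rewrite !alg_hom1. Qed.
Next Obligation. by move=> A B C g f a x /=; rewrite !alg_homZ. Qed.

Program Definition Alg : category :=
  @Category (algebra R) alg_hom alg_id alg_comp _ _ _.
Next Obligation. by move=> A B f; exact: alg_hom_eq. Qed.
Next Obligation. by move=> A B f; exact: alg_hom_eq. Qed.
Next Obligation. by move=> A B C D h g f; exact: alg_hom_eq. Qed.

End AlgebraCategory.

Section FunAlgebra.
Variable R : realType.

(* Subalgebras of the algebra of all functions T -> R. *)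
Record fun_algebra (T : Type) := FunAlgebra {
  fun_set :> (T -> R) -> Prop;
  fun_set1 : fun_set 1;
  fun_setL : forall (a : R) (f g : T -> R),
    fun_set f -> fun_set g -> fun_set (a *: f + g);
  fun_setM : forall f g : T -> R, fun_set f -> fun_set g -> fun_set (f * g)
}.

Section Carrier.
Variables (T : Type) (C : fun_algebra T).

Definition fun_pred : {pred T -> R} := fun f => `[< C f >].

Record fun_sort := Fun { fun_val :> T -> R; _ : fun_pred fun_val }.

HB.instance Definition _ := [isSub for fun_val].
HB.instance Definition _ := [Choice of fun_sort by <:].

Lemma fun_valP (f : fun_sort) : C f.
Proof. by case: f => f /= /asboolP. Qed.

Definition mk_fun (f : T -> R) (Cf : C f) : fun_sort := @Fun f (asboolT Cf).

Fact fun_pred_subring : subring_closed fun_pred.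
Proof.
split.
- by apply/asboolP; exact: fun_set1.
- move=> f g /asboolP Cf /asboolP Cg; apply/asboolP.
  by rewrite addrC -scaleN1r; exact: fun_setL.
- by move=> f g /asboolP Cf /asboolP Cg; apply/asboolP; exact: fun_setM.
Qed.

HB.instance Definition _ :=
  GRing.isSubringClosed.Build (T -> R) fun_pred fun_pred_subring.

Fact fun_pred_scale : scaler_closed fun_pred.
Proof.
move=> a f /asboolP Cf; apply/asboolP; rewrite -[_ *: _]addr0.
apply: fun_setL => //.
by rewrite -(subrr (1 : T -> R)) addrC -scaleN1r; apply: fun_setL; exact: fun_set1.
Qed.

HB.instance Definition _ :=
  GRing.isScaleClosed.Build R (T -> R) fun_pred fun_pred_scale.

HB.instance Definition _ :=
  GRing.SubChoice_isSubComPzRing.Build (T -> R) fun_pred fun_sort fun_pred_subring.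
HB.instance Definition _ := [SubZmodule_isSubLmodule of fun_sort by <:].

Fact fun_scaleMl (a : R) (f g : fun_sort) : a *: (f * g) = (a *: f) * g.
Proof. by apply: val_inj; apply/funext => x; exact: mulrA. Qed.

Fact fun_scaleMr (a : R) (f g : fun_sort) : a *: (f * g) = f * (a *: g).
Proof. by rewrite mulrC fun_scaleMl mulrC. Qed.

Definition fun_alg : algebra R :=
  @Algebra R fun_sort *:%R (@scalerA _ _) (@scale1r _ _) (@scalerDr _ _)
    (fun a b x => scalerDl x a b) fun_scaleMl fun_scaleMr.

End Carrier.

Section Stalk.
Variables (T : topologicalType) (C : fun_algebra T) (x : T).

Definition same_germ : rel (fun_sort C) :=
  fun f g => `[< \forall y \near x, f y = g y >].

Fact same_germ_refl : reflexive same_germ.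
Proof. by move=> f; apply/asboolP; exact: nearW. Qed.

Fact same_germ_sym : symmetric same_germ.
Proof.
by move=> f g; apply/asboolP/asboolP; apply: filterS => y.
Qed.

Fact same_germ_trans : transitive same_germ.
Proof.
move=> g f h /asboolP fg /asboolP gh; apply/asboolP.
by apply: filterS2 fg gh => y ->.
Qed.

Canonical same_germ_equiv :=
  EquivRel same_germ same_germ_refl same_germ_sym same_germ_trans.

Definition stalk := {eq_quot same_germ}.
HB.instance Definition _ : EqQuotient _ same_germ stalk := EqQuotient.on stalk.
HB.instance Definition _ := Choice.on stalk.

Definition germ (f : fun_sort C) : stalk := \pi_stalk f.

Lemma germP f g : germ f = germ g <-> \forall y \near x, f y = g y.
Proof.
split=> [/(@eqquotP _ same_germ stalk)/asboolP //|fg].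
by apply/(@eqquotP _ same_germ stalk)/asboolP.
Qed.

Lemma germ_repr a : germ (repr a) = a.
Proof. exact: reprK. Qed.

Definition stalk_zero : stalk := germ 0.
Definition stalk_one : stalk := germ 1.
Definition stalk_opp (a : stalk) : stalk := germ (- repr a).
Definition stalk_add (a b : stalk) : stalk := germ (repr a + repr b).
Definition stalk_mul (a b : stalk) : stalk := germ (repr a * repr b).
Definition stalk_scale (r : R) (a : stalk) : stalk := germ (r *: repr a).

Definition germ_eval (a : stalk) : R := (repr a : fun_sort C) x.

Lemma near_repr f : \forall y \near x, repr (germ f) y = f y.
Proof. by apply/germP; rewrite germ_repr. Qed.

Lemma germ_evalE f : germ_eval (germ f) = f x.
Proof. exact: nbhs_singleton (near_repr f). Qed.

Lemma germN f : stalk_opp (germ f) = germ (- f).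
Proof. by apply/germP; apply: filterS (near_repr f) => y /= e; congr (- _). Qed.

Lemma germD f g : stalk_add (germ f) (germ g) = germ (f + g).
Proof.
by apply/germP; apply: filterS2 (near_repr f) (near_repr g) => y /= e1 e2;
  congr (_ + _).
Qed.

Lemma germM f g : stalk_mul (germ f) (germ g) = germ (f * g).
Proof.
by apply/germP; apply: filterS2 (near_repr f) (near_repr g) => y /= e1 e2;
  congr (_ * _).
Qed.

Lemma germZ r f : stalk_scale r (germ f) = germ (r *: f).
Proof. by apply/germP; apply: filterS (near_repr f) => y /= e; congr (_ * _). Qed.

Lemma germ_ind (P : stalk -> Prop) : (forall f, P (germ f)) -> forall a, P a.
Proof. by move=> Pg a; rewrite -(germ_repr a). Qed.

Fact stalk_addA : associative stalk_add.
Proof.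
by elim/germ_ind=> f; elim/germ_ind=> g; elim/germ_ind=> h; rewrite !germD addrA.
Qed.
Fact stalk_addC : commutative stalk_add.
Proof. by elim/germ_ind=> f; elim/germ_ind=> g; rewrite !germD addrC. Qed.
Fact stalk_add0 : left_id stalk_zero stalk_add.
Proof. by elim/germ_ind=> f; rewrite germD add0r. Qed.
Fact stalk_addN : left_inverse stalk_zero stalk_opp stalk_add.
Proof. by elim/germ_ind=> f; rewrite germN germD addNr. Qed.

HB.instance Definition _ :=
  GRing.isZmodule.Build stalk stalk_addA stalk_addC stalk_add0 stalk_addN.

Fact stalk_mulA : associative stalk_mul.
Proof.
by elim/germ_ind=> f; elim/germ_ind=> g; elim/germ_ind=> h; rewrite !germM mulrA.
Qed.
Fact stalk_mulC : commutative stalk_mul.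
Proof. by elim/germ_ind=> f; elim/germ_ind=> g; rewrite !germM mulrC. Qed.
Fact stalk_mul1 : left_id stalk_one stalk_mul.
Proof. by elim/germ_ind=> f; rewrite germM mul1r. Qed.
Fact stalk_mulDl : left_distributive stalk_mul +%R.
Proof.
by elim/germ_ind=> f; elim/germ_ind=> g; elim/germ_ind=> h;
  rewrite /GRing.add /= !(germD, germM) mulrDl.
Qed.

HB.instance Definition _ :=
  GRing.Zmodule_isComPzRing.Build stalk stalk_mulA stalk_mulC stalk_mul1 stalk_mulDl.

Fact stalk_scaleA r s a : stalk_scale r (stalk_scale s a) = stalk_scale (r * s) a.
Proof. by elim/germ_ind: a => f; rewrite !germZ scalerA. Qed.
Fact stalk_scale1 : left_id 1 stalk_scale.
Proof. by elim/germ_ind=> f; rewrite germZ scale1r. Qed.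
Fact stalk_scaleDr : right_distributive stalk_scale +%R.
Proof.
by move=> r; elim/germ_ind=> f; elim/germ_ind=> g;
  rewrite /GRing.add /= !(germD, germZ) scalerDr.
Qed.
Fact stalk_scaleDl a : {morph stalk_scale^~ a : r s / r + s}.
Proof.
by elim/germ_ind: a => f r s; rewrite [in RHS]/GRing.add /= !(germD, germZ) scalerDl.
Qed.

HB.instance Definition _ := GRing.Zmodule_isLmodule.Build R stalk
  stalk_scaleA stalk_scale1 stalk_scaleDr stalk_scaleDl.

Fact stalk_scaleMl (r : R) (a b : stalk) : r *: (a * b) = (r *: a) * b.
Proof.
elim/germ_ind: a => f; elim/germ_ind: b => g.
by rewrite /GRing.scale /GRing.mul /= !(germM, germZ) fun_scaleMl.
Qed.

Fact stalk_scaleMr (r : R) (a b : stalk) : r *: (a * b) = a * (r *: b).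
Proof. by rewrite mulrC stalk_scaleMl mulrC. Qed.

Definition stalk_alg : algebra R :=
  @Algebra R stalk *:%R (@scalerA _ _) (@scale1r _ _) (@scalerDr _ _)
    (fun a b x => scalerDl x a b) stalk_scaleMl stalk_scaleMr.

(* Derivations of the stalk at x into R, as a subspace of all functions. *)
Definition tangent_space : set (stalk -> R) :=
  [set D : stalk -> R | scalar D /\
           forall a b, D (a * b) = germ_eval a * D b + germ_eval b * D a].

End Stalk.
End FunAlgebra.

Section Dimension.
Variables (R : pzRingType) (E : lmodType R).

Definition has_dim (V : set E) (m : nat) : Prop :=
  exists e : 'I_m -> E,
  [/\ forall i, V (e i),
      forall a : 'I_m -> R, \sum_i a i *: e i = 0 -> forall i, a i = 0
    & forall v, V v -> exists a : 'I_m -> R, v = \sum_i a i *: e i].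

Definition dim_le (V : set E) (k : nat) : Prop :=
  exists2 m, (m <= k)%N & has_dim V m.

End Dimension.

Section Smooth.
Variables (R : realType) (n : nat).
Implicit Types (U : set 'rV[R]_n) (g h : 'rV[R]_n -> R).

(* All partial derivatives of order at most m exist and are continuous at the
   points of U, which is meant to be open. *)
Fixpoint Ck_on U (m : nat) g : Prop :=
  (forall v, U v -> {for v, continuous g}) /\
  if m is m'.+1 then
    forall i : 'I_n, (forall v, U v -> derivable g v (delta_mx 0 i)) /\
                     Ck_on U m' (fun v => 'D_(delta_mx 0 i) g v)
  else True.

Definition smooth_on U g : Prop := forall m, Ck_on U m g.

Lemma eq_Ck_on U m g h : open U -> (forall v, U v -> g v = h v) ->
  Ck_on U m g -> Ck_on U m h.
Proof.
move=> oU; elim: m g h => [|m IH] g h gh [cg dg].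
all: have ngh v : U v -> {near v, g =1 h} by
  move=> Uv; have := open_nbhs_nbhs (conj oU Uv); apply: filterS => w; exact: gh.
all: have ch v : U v -> {for v, continuous h} by
  move=> Uv; rewrite /prop_for /continuous_at -gh //;
  exact: cvg_trans (near_eq_cvg (ngh v Uv)) (cg v Uv).
  by [].
split=> // i; have [dgi Cgi] := dg i; split=> [v Uv|].
  by apply: near_eq_derivable (dgi v Uv); exact: ngh.
by apply: IH Cgi => v Uv; apply: near_eq_derive; exact: ngh.
Qed.

Lemma Ck_onW U m g : Ck_on U m.+1 g -> Ck_on U m g.
Proof.
elim: m g => [|m IH] g [cg dg]; split=> // i.
by have [dgi Cgi] := dg i; split=> //; exact: IH.
Qed.

Lemma Ck_onD U m g h : open U -> Ck_on U m g -> Ck_on U m h -> Ck_on U m (g + h).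
Proof.
move=> oU; elim: m g h => [|m IH] g h [cg dg] [ch dh].
  by split=> // v Uv; exact: continuousD (cg v Uv) (ch v Uv).
split=> [v Uv|i]; first by exact: continuousD (cg v Uv) (ch v Uv).
have [dgi Cgi] := dg i; have [dhi Chi] := dh i; split=> [v Uv|].
  by apply: derivableD; [exact: dgi|exact: dhi].
apply: eq_Ck_on (IH _ _ Cgi Chi) => // v Uv.
by rewrite deriveD //; [exact: dgi|exact: dhi].
Qed.

Lemma Ck_onM U m g h : open U -> Ck_on U m g -> Ck_on U m h -> Ck_on U m (g * h).
Proof.
move=> oU; elim: m g h => [|m IH] g h Cg Ch; have [cg dg] := Cg; have [ch dh] := Ch.
  by split=> // v Uv; exact: continuousM (cg v Uv) (ch v Uv).
split=> [v Uv|i]; first by exact: continuousM (cg v Uv) (ch v Uv).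
have [dgi Cgi] := dg i; have [dhi Chi] := dh i; split=> [v Uv|].
  by apply: derivableM; [exact: dgi|exact: dhi].
apply: eq_Ck_on (Ck_onD oU (IH _ _ (Ck_onW Cg) Chi) (IH _ _ (Ck_onW Ch) Cgi)) => // v Uv.
by rewrite deriveM //; [exact: dgi|exact: dhi].
Qed.

Lemma Ck_on_cst U m (a : R) : open U -> Ck_on U m (cst a).
Proof.
move=> oU; have ca (b : R) : forall v, U v -> {for v, continuous (cst b : 'rV[R]_n -> R)}.
  by move=> v _; apply: cst_continuous.
elim: m a => [|m IH] a; (split; first exact: ca) => //.
move=> i; split=> [v _|]; first by apply: derivable_cst.
by apply: (@eq_Ck_on U m (cst 0)) => // v _; rewrite derive_cst.
Qed.

End Smooth.

Section Manifold.
Variables (R : realType) (M : topologicalType) (k : nat).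

(* A homeomorphism from an open subset of M onto an open subset of R^k; the
   values of the two maps outside these subsets are irrelevant. *)
Record chart := Chart {
  chart_dom : set M;
  chart_cod : set 'rV[R]_k;
  chart_to :> M -> 'rV[R]_k;
  chart_inv : 'rV[R]_k -> M;
  chart_dom_open : open chart_dom;
  chart_cod_open : open chart_cod;
  chart_toP : forall p, chart_dom p -> chart_cod (chart_to p);
  chart_invP : forall v, chart_cod v -> chart_dom (chart_inv v);
  chart_toK : forall p, chart_dom p -> chart_inv (chart_to p) = p;
  chart_invK : forall v, chart_cod v -> chart_to (chart_inv v) = v;
  chart_to_cont : forall p, chart_dom p -> {for p, continuous chart_to};
  chart_inv_cont : forall v, chart_cod v -> {for v, continuous chart_inv}
}.

Record smooth_manifold := SmoothManifold {
  mfd_hausdorff : hausdorff_space M;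
  mfd_countable : @second_countable M;
  atlas : set chart;
  atlas_cover : forall p, exists2 c, atlas c & chart_dom c p;
  atlas_smooth : forall c d, atlas c -> atlas d -> forall i : 'I_k,
    smooth_on (chart_cod c `&` [set v | chart_dom d (chart_inv c v)])
              (fun v => d (chart_inv c v) 0 i)
}.

Variable A : smooth_manifold.

Definition smooth_fun (f : M -> R) : Prop :=
  forall c, atlas A c -> smooth_on (chart_cod c) (f \o chart_inv c).

Fact smooth_fun1 : smooth_fun 1.
Proof. by move=> c _ m; apply: Ck_on_cst; exact: chart_cod_open. Qed.

Fact smooth_funL (a : R) (f g : M -> R) :
  smooth_fun f -> smooth_fun g -> smooth_fun (a *: f + g).
Proof.
move=> sf sg c Ac m; have oc := @chart_cod_open c.
apply: (Ck_onD (g := cst a * (f \o chart_inv c)) oc _ (sg c Ac m)).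
by apply: (Ck_onM oc) (sf c Ac m); exact: Ck_on_cst.
Qed.

Fact smooth_funM (f g : M -> R) : smooth_fun f -> smooth_fun g -> smooth_fun (f * g).
Proof.
move=> sf sg c Ac m.
by apply: Ck_onM (sf c Ac m) (sg c Ac m); exact: chart_cod_open.
Qed.

Definition Cinfty : fun_algebra R M :=
  FunAlgebra smooth_fun1 smooth_funL smooth_funM.

End Manifold.

Section Diffspace.
Variable R : realType.

Record diffspace := Diffspace {
  ds_space :> topologicalType;
  ds_fun : fun_algebra R ds_space;
  ds_cont : forall f, ds_fun f -> continuous f;
  ds_local : forall f : ds_space -> R,
    ds_fun f <->
    forall x, exists U g, [/\ open U, U x, ds_fun g & forall y, U y -> f y = g y];
  ds_closed : forall (n : nat) (f : 'I_n -> ds_space -> R) (g : 'rV[R]_n -> R),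
    (0 < n)%N -> (forall i, ds_fun (f i)) -> smooth_on setT g ->
    ds_fun (fun x => g (\row_i f i x))
}.

Record diff_hom (S S' : diffspace) := DiffHom {
  diff_hom_fun :> S -> S';
  diff_hom_cont : continuous diff_hom_fun;
  diff_homP : forall f, ds_fun S' f -> ds_fun S (f \o diff_hom_fun)
}.

Lemma diff_hom_eq (S S' : diffspace) (f g : diff_hom S S') : f =1 g -> f = g.
Proof.
case: f => f fc fP; case: g => g gc gP /= /funext efg.
by case: g / efg in gc gP *; congr DiffHom; exact: Prop_irrelevance.
Qed.

Definition diff_id (S : diffspace) : diff_hom S S :=
  @DiffHom S S id (fun x => @cvg_id _ (nbhs x)) (fun _ => id).

Definition diff_comp (S1 S2 S3 : diffspace) (g : diff_hom S2 S3)
    (f : diff_hom S1 S2) : diff_hom S1 S3 :=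
  @DiffHom S1 S3 (g \o f)
    (fun x => continuous_comp (@diff_hom_cont _ _ f x) (@diff_hom_cont _ _ g (f x)))
    (fun h Sh => diff_homP f (diff_homP g Sh)).

Program Definition Diffsp : category :=
  @Category diffspace diff_hom diff_id diff_comp _ _ _.
Next Obligation. by move=> A B f; exact: diff_hom_eq. Qed.
Next Obligation. by move=> A B f; exact: diff_hom_eq. Qed.
Next Obligation. by move=> A B C D h g f; exact: diff_hom_eq. Qed.

Section Stratifold.
Variable S : diffspace.

Definition skeleton (k : nat) : set S :=
  [set x | dim_le (@tangent_space R S (ds_fun S) x) k].

Definition stratum (k : nat) : set S :=
  skeleton k `\` (if k is k'.+1 then skeleton k' else set0).

(* Restriction of functions along the inclusion of a subset A of S maps the
   algebra of S into the algebra D, and the map it induces on germs at x is an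
   isomorphism of algebras. *)
Definition restriction_iso (A : set S) (D : fun_algebra R (set_type A))
    (x : set_type A) : Prop :=
  exists phi : alg_hom (stalk_alg (ds_fun S) (set_val x)) (stalk_alg D x),
    bijective phi /\
    forall f : fun_sort (ds_fun S),
      exists2 g : fun_sort D, fun_val g = f \o set_val & phi (germ _ f) = germ _ g.

Definition supp (f : S -> R) : set S := closure [set x | f x != 0].

Record is_stratifold : Prop := IsStratifold {
  sf_locally_compact : locally_compact [set: S];
  sf_hausdorff : hausdorff_space S;
  sf_second_countable : @second_countable S;
  sf_skeleton : forall k, closed (skeleton k);
  sf_bump : forall (x : S) (U : set S), open U -> U x ->
    exists rho : S -> R, [/\ ds_fun S rho, forall y, 0 <= rho y, rho x != 0
                           & supp rho `<=` U];
  sf_stratum : forall k, exists A : smooth_manifold R (set_type (stratum k)) k,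
    forall x, restriction_iso (Cinfty A) x;
  sf_finite : exists n, skeleton n = [set: S]
}.

End Stratifold.

Definition Stfd : category := @full_subcategory Diffsp is_stratifold.

Section Pullback.
Variables (S S' : diffspace) (phi : diff_hom S S').

Definition pullback (g : fun_sort (ds_fun S')) : fun_sort (ds_fun S) :=
  mk_fun (diff_homP phi (fun_valP g)).

Program Definition pullback_alg : alg_hom (fun_alg (ds_fun S')) (fun_alg (ds_fun S)) :=
  @AlgHom R (fun_alg (ds_fun S')) (fun_alg (ds_fun S)) pullback _ _ _ _.
Next Obligation. by move=> f g; exact: val_inj. Qed.
Next Obligation. by move=> f g; exact: val_inj. Qed.
Next Obligation. by exact: val_inj. Qed.
Next Obligation. by move=> a f; exact: val_inj. Qed.

End Pullback.

Program Definition function_functor : contra_functor Stfd (Alg R) :=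
  @ContraFunctor Stfd (Alg R) (fun S => fun_alg (ds_fun (sval S)))
    (fun S S' phi => pullback_alg phi) _ _.
Next Obligation. by move=> S; apply: alg_hom_eq => g; exact: val_inj. Qed.
Next Obligation. by move=> S1 S2 S3 g f; apply: alg_hom_eq => h; exact: val_inj. Qed.

End Diffspace.

(* Main.v *)
(* Every unital character of the algebra of a stratifold is the evaluation at a
   point, by the argument of "Milnor's exercise". There is a function f in the
   algebra whose sublevel sets are relatively compact. If a character chi is not
   the evaluation at any point, then each point has a function of the kernel of
   chi that does not vanish there; finitely many of their squares cover the
   level set f = chi f, and adding (f - chi f)^2 to their sum gives a nowhere
   vanishing, hence invertible, element of the kernel, which is absurd. Applied
   to the characters g |-> alpha g x, this recovers the map inducing alpha; it is
   continuous and unique because the bump functions of a stratifold determine its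
   topology and separate its points. *)
Require Import Defs.
From mathcomp Require Import all_boot all_order all_algebra.
From mathcomp Require Import boolp classical_sets functions cardinality reals.
From mathcomp Require Import topology normedtype derive.

Set Implicit Arguments.
Unset Strict Implicit.
Unset Printing Implicit Defensive.

Import Order.TTheory GRing.Theory Num.Theory.
Import numFieldNormedType.Exports.

Local Open Scope classical_set_scope.
Local Open Scope ring_scope.

(** * Reciprocals of differentiable functions *)

Lemma Ck_onV (R : realType) (n : nat) (U : set 'rV[R]_n) (m : nat)
    (h : 'rV[R]_n -> R) :
  open U -> (forall v, U v -> h v != 0) -> Ck_on U m h ->
  Ck_on U m (fun v => (h v)^-1).
Proof.
move=> oU h0; elim: m => [|m IH] Ch; have [ch dh] := Ch.
  by split=> // v Uv; exact: continuousV (h0 v Uv) (ch v Uv).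
split=> [v Uv|i]; first exact: continuousV (h0 v Uv) (ch v Uv).
have [dhi Chi] := dh i; split=> [v Uv|].
  by apply: derivableV; [exact: h0|exact: dhi].
(* The derivative of [k] is [-1 * (k * k)] times that of [h], a product of factors already known to
   be of class [m]. *)
pose k v := (h v)^-1; have Ck : Ck_on U m k := IH (Ck_onW Ch).
have Ckk := Ck_onM oU (Ck_on_cst m (-1) oU) (Ck_onM oU Ck Ck).
apply: eq_Ck_on (Ck_onM oU Ckk Chi) => // v Uv.
rewrite deriveV; [|exact: h0|exact: dhi].
change (-1 * ((h v)^-1 * (h v)^-1) * 'D_(delta_mx 0 i) h v =
        - (h v ^+ 2)^-1 * 'D_(delta_mx 0 i) h v).
by rewrite mulN1r expr2 invfM.
Qed.

(** * Compactness: an induction principle and exhaustions *)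

(** Were [P K] false, the sets whose complement in [K] satisfies [P] would form a proper filter; the
    local hypothesis at a cluster point in [K] contradicts this. It stands in for extracting finite
    subcovers. *)
Lemma compact_union_ind (T : topologicalType) (P : set T -> Prop) (K : set T) :
  P set0 -> (forall A B, A `<=` B -> P B -> P A) ->
  (forall A B, P A -> P B -> P (A `|` B)) ->
  (forall x, K x -> exists2 A, nbhs x A & P A) -> compact K -> P K.
Proof.
move=> P0 PS PU Ploc cK; apply: contrapT => nPK.
pose F : set_system T := [set A | P (K `\` A)].
have FF : ProperFilter F.
  split; first by rewrite /F /= setD0.
  split; first by rewrite /F /= setDT.
    by move=> A B PA PB; rewrite /F /= setDIr; exact: PU.
  by move=> A B AB; apply: PS; exact: setDS.
have FK : F K by rewrite /F /= setDv.
have [x [Kx clx]] := cK F FF FK.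
have [A nA PA] := Ploc x Kx.
have FA : F (~` A) by apply: PS PA => y [_ /contrapT].
by have [y [/= nAy Ay]] := clx _ _ FA nA.
Qed.

Lemma compact_exhaustion (T : topologicalType) :
  locally_compact [set: T] -> @second_countable T ->
  exists K : nat -> set T, [/\ forall n, compact (K n),
    forall n, K n `<=` (K n.+1)^° & forall x, exists n, K n x].
Proof.
move=> lcT [B cB [Bo Bb]].
have locT (x : T) : exists2 L, nbhs x L & compact L /\ closed L.
  have [L nL cL] := lcT x I; exists L => //.
  by move: nL; rewrite /within /= => nL; apply: filterS nL => y; exact.
have [f injf] : exists f : set T -> nat, set_inj B f by exact/countable_injP.
(* [D n] is the closure of the basic open set numbered [n] when that closure is compact, and is
   empty otherwise. *)
pose D n := [set x | exists b, [/\ B b, f b = n, compact (closure b) & closure b x]].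
have cD n : compact (D n).
  have [[b [Bb' fb cb]]|nD] :=
      pselect (exists b, [/\ B b, f b = n & compact (closure b)]).
    rewrite (_ : D n = closure b) //; apply/seteqP; split=> x.
      by move=> [b' [Bb1 fb' _]]; rewrite (injf b' b) ?inE// fb fb'.
    by move=> bx; exists b.
  rewrite (_ : D n = set0); first exact: compact0.
  by apply/seteqP; split=> x // [b [? ? ? _]]; apply: nD; exists b.
(* [nb A] is a compact neighbourhood of a compact [A]; other values are irrelevant. *)
have /choice[nb nbP] (A : set T) : exists L, compact A -> compact L /\ A `<=` L^°.
  have [cA|] := pselect (compact A); last by exists set0.
  suff [L] : exists L, compact L /\ A `<=` L^° by exists L.
  apply: (compact_union_ind (P := fun A => exists L, compact L /\ A `<=` L^°)) cA.
  - by exists set0; split=> //; exact: compact0.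
  - by move=> A1 A2 A12 [L [cL AL]]; exists L; split=> //; exact: subset_trans AL.
  - move=> A1 A2 [L1 [c1 s1]] [L2 [c2 s2]]; exists (L1 `|` L2).
    split; first exact: compactU.
    move=> x [/s1|/s2]; apply: (@interiorS _ _ (L1 `|` L2)) => y;
      [by left|by right].
  - move=> x _; have [L nL [cL _]] := locT x; exists L^°.
      exact: nbhs_interior.
    by exists L; split.
(* The sets [D m] reach every point, while [nb (K m)] puts [K m] in the interior of the next set. *)
pose K := fix K n := if n is m.+1 then D m `|` nb (K m) else set0.
have cK n : compact (K n).
  elim: n => [|n IH] /=; first exact: compact0.
  by apply: compactU => //; case: (nbP _ IH).
exists K; split=> //.
  move=> n x Kx; have [_ /(_ x Kx)] := nbP _ (cK n).
  by apply: interiorS => y ny; right.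
move=> x; have [L nL [cL clL]] := locT x.
have [b [Bb1 bx] bL] := Bb x L nL.
exists (f b).+1; left; exists b; split=> //; last exact: subset_closure.
apply: subclosed_compact cL _; first exact: closed_closure.
by move/closure_id: clL => ->; exact: closureS.
Qed.

(** * Operations in a subalgebra of functions *)

Lemma fun_setB (R : realType) (T : Type) (C : fun_algebra R T) (f g : T -> R) :
  C f -> C g -> C (f - g).
Proof.
move=> Cf Cg; rewrite addrC (_ : - g = (-1) *: g); first exact: fun_setL.
by rewrite scaleN1r.
Qed.

Lemma fun_set0 (R : realType) (T : Type) (C : fun_algebra R T) : C 0.
Proof. by rewrite -(subrr 1); apply: fun_setB; exact: fun_set1. Qed.

Lemma fun_setZ (R : realType) (T : Type) (C : fun_algebra R T) (a : R) f :
  C f -> C (a *: f).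
Proof. by move=> Cf; rewrite -[_ *: f]addr0; apply: fun_setL => //; exact: fun_set0. Qed.

Lemma fun_setD (R : realType) (T : Type) (C : fun_algebra R T) (f g : T -> R) :
  C f -> C g -> C (f + g).
Proof. by move=> Cf Cg; rewrite -[f]scale1r; exact: fun_setL. Qed.

Lemma fun_set_sum (R : realType) (T : Type) (C : fun_algebra R T) (I : Type)
    (r : seq I) (F : I -> T -> R) :
  (forall i, C (F i)) -> C (\sum_(i <- r) F i).
Proof. by move=> CF; elim/big_ind: _ => //; [exact: fun_set0|exact: fun_setD]. Qed.

(** * Inverting nowhere vanishing functions *)

Lemma stratum_cover (R : realType) (S : diffspace R) (x : S) :
  is_stratifold S -> exists k, stratum k x.
Proof.
move=> [_ _ _ _ _ _ [n skn]].
have ex : exists n, `[< skeleton n x >] by exists n; apply/asboolP; rewrite skn.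
have [k /asboolP xk min] := ex_minnP ex.
exists k; split; first exact: xk.
case: k {xk} min => [|k] min /=; first by case.
by move=> xk; have := min k (asboolT xk); rewrite ltnn.
Qed.

(* Inverting the germ in the algebra of the stratum and transporting it back along
   the isomorphism of stalks avoids extending t |-> 1/t smoothly to R. *)
Lemma stratifold_funV (R : realType) (S : diffspace R) (h : S -> R) :
  is_stratifold S -> ds_fun S h -> (forall x, h x != 0) ->
  ds_fun S (fun x => (h x)^-1).
Proof.
move=> sS Sh h0; apply/ds_local => x.
have [k xk] := stratum_cover x sS.
have [A iA] := sf_stratum sS k.
have [phi [bphi resphi]] := iA (SigSub (mem_set xk)).
have [h' h'E phih] := resphi (mk_fun Sh).
have sk : Cinfty A (fun p => (h' p)^-1).
  move=> c Ac m; apply: Ck_onV; first exact: chart_cod_open.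
    by move=> v _; rewrite h'E; exact: h0.
  exact: (fun_valP h') c Ac m.
have [psi phiK psiK] := bphi.
(* Surjectivity of [phi] yields [g] over the germ of the reciprocal on the stratum; injectivity then
   gives [h * g = 1] on a neighbourhood of [x] in [S], not only on the stratum. *)
have [g gE] : exists g : fun_sort (ds_fun S), phi (germ _ g) = germ _ (mk_fun sk).
  by exists (repr (psi (germ _ (mk_fun sk)))); rewrite germ_repr psiK.
pose y := SigSub (mem_set xk) : set_type (stratum k).
have : germ (set_val y) (mk_fun Sh * g) = germ (set_val y) 1.
  apply: (bij_inj bphi); rewrite -germM.
  have -> : germ (set_val y) 1 = 1 :> stalk_alg (ds_fun S) (set_val y) by [].
  rewrite alg_homM phih gE alg_hom1.
  transitivity (germ y (h' * mk_fun sk)); first exact: germM.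
  congr germ; apply: val_inj; apply/funext => z /=.
  change (h' z * (h' z)^-1 = 1); rewrite mulfV // h'E; exact: h0.
rewrite set_valE /= => /germP hg.
exists [set z | h z * g z = 1]^°, g; split.
- exact: open_interior.
- exact: hg.
- exact: fun_valP.
- move=> z /interior_subset /= hgz.
  by rewrite -[LHS]mulr1 -hgz mulKf.
Qed.

(** * Bump functions and a proper function *)

Lemma compact_bump (R : realType) (S : diffspace R) (K U : set S) :
  is_stratifold S -> compact K -> open U -> K `<=` U ->
  exists rho : S -> R, [/\ ds_fun S rho, forall y, 0 <= rho y,
    forall y, K y -> 1 <= rho y & forall y, ~ U y -> rho y = 0].
Proof.
move=> sS cK oU KU.
pose P (A : set S) := exists rho : S -> R, [/\ ds_fun S rho,
  forall y, 0 <= rho y, forall y, A y -> 1 <= rho y & forall y, ~ U y -> rho y = 0].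
apply: (compact_union_ind (P := P)) cK.
- by exists 0; split=> //; exact: fun_set0.
- by move=> A B AB [rho [? ? B1 ?]]; exists rho; split=> // y /AB/B1.
- move=> A B [f [Cf f0 f1 fU]] [g [Cg g0 g1 gU]]; exists (f + g); split.
  + exact: fun_setD.
  + by move=> y; exact: addr_ge0.
  + by move=> y [/f1 fy|/g1 gy]; [exact: ler_wpDr|exact: ler_wpDl].
  + by move=> y nU; rewrite /GRing.add /= fU // gU // addr0.
- move=> x /KU Ux; have [rho [Cr r0 rx sr]] := sf_bump sS oU Ux.
  (* The value 2 at [x] leaves room: by continuity [f] still exceeds 1 near [x]. *)
  pose f := (2 / rho x) *: rho.
  have Cf : ds_fun S f by exact: fun_setZ.
  have fx : f x = 2 by change (2 / rho x * rho x = 2); rewrite divfK.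
  exists [set y | 1 < f y].
    by apply: (cvgr_gt (f x) (ds_cont Cf (x := x)) 1); rewrite fx ltr1n.
  exists f; split=> //.
  + by move=> y; rewrite mulr_ge0 // divr_ge0.
  + by move=> y /ltW.
  + move=> y nU; change (2 / rho x * rho y = 0).
    have [->|ry] := eqVneq (rho y) 0; first by rewrite mulr0.
    by case: nU; apply: sr; exact: subset_closure.
Qed.

(* f is the locally finite sum of j.+1 * psi j, where psi j is at least 1 on the
   shell between K j.+1 and K j.+2 and vanishes on K j. *)
Lemma proper_fun (R : realType) (S : diffspace R) :
  is_stratifold S -> exists2 f : S -> R, ds_fun S f &
  forall N : nat, exists2 K, compact K & [set x | f x < N%:R] `<=` K.
Proof.
move=> sS.
have [K [cK KS Kcov]] :=
  compact_exhaustion (sf_locally_compact sS) (sf_second_countable sS).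
have clK n : closed (K n) by exact: compact_closed (sf_hausdorff sS) (cK n).
have Kmono m n : (m <= n)%N -> K m `<=` K n.
  move=> /subnK <-; elim: (n - m)%N => [//|d IH] x /IH /KS.
  exact: interior_subset.
have /choice[psi psiP] (n : nat) : exists rho : S -> R, [/\ ds_fun S rho,
    forall y, 0 <= rho y, forall y, (K n.+2 `\` (K n.+1)^°) y -> 1 <= rho y
    & forall y, K n y -> rho y = 0].
  have [|||rho [? ? ? rK]] :=
      @compact_bump R S (K n.+2 `\` (K n.+1)^°) (~` K n) sS.
  - by apply: compact_closedI => //; exact/open_closedC/open_interior.
  - exact/closed_openC.
  - by move=> y [_ nKy] /KS.
  - by exists rho; split=> // y Ky; apply: rK; apply.
have /choice[N NP] := Kcov.
pose F n : S -> R := \sum_(j < n) j.+1%:R *: psi j.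
have FE n x : F n x = \sum_(j < n) j.+1%:R * psi j x.
  by rewrite /F fct_sumE.
(* Terms of index at least [m] vanish on [K m], so the partial sums stabilise there. *)
have Fstab m n x : (m <= n)%N -> K m x -> F n x = F m x.
  move=> mn Kx; rewrite !FE -(subnKC mn) big_split_ord /=.
  rewrite [X in _ + X]big1 ?addr0 // => j _.
  have [_ _ _ ->] := psiP (m + j)%N; first by rewrite mulr0.
  by apply: Kmono Kx; exact: leq_addr.
pose f x := F (N x) x.
have fE n x : K n x -> f x = F n x.
  move=> Kx; have [nN|Nn] := leqP n (N x); first exact: Fstab.
  by apply/esym/Fstab; [exact: ltnW|exact: NP].
exists f.
  apply/ds_local => x; exists (K (N x).+1)^°, (F (N x).+1); split.
  - exact: open_interior.
  - exact/KS/NP.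
  - by apply: fun_set_sum => j; apply: fun_setZ; case: (psiP j).
  - by move=> y /interior_subset; exact: fE.
(* For [x] outside [K n.+1], the first set containing [x] has index [m.+2] with [n <= m]; so [x]
   lies in the shell of [psi m], whose term alone is at least [m.+1]. *)
move=> n; exists (K n.+1) => // x /= fxn; apply: contrapT => nKx.
have : exists m, `[< K m x >] by exists (N x); apply/asboolP.
case/ex_minnP => m /asboolP Kx min.
have nm : (n.+1 < m)%N.
  by rewrite ltnNge; apply/negP => mn; apply: nKx; exact: Kmono Kx.
case: m nm Kx min => [|[|m]] // nm Kx min.
have p1 : 1 <= psi m x.
  have [_ _ + _] := psiP m; apply; split=> // /interior_subset Kx1.
  by have := min m.+1 (asboolT Kx1); rewrite ltnn.
move: fxn; apply/negP; rewrite -leNgt (fE m.+2) // FE.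
rewrite (bigD1 (Ordinal (ltnW (ltnSn m.+1)))) //=.
apply: ler_wpDr.
  apply: sumr_ge0 => j _; apply: mulr_ge0 => //.
  by have [_ + _ _] := psiP j; exact.
rewrite -[leLHS]mulr1; apply: ler_pM => //.
by rewrite ler_nat; exact: leqW.
Qed.

(** * Characters are evaluations *)

Lemma character_eval (R : realType) (S : diffspace R)
    (chi : fun_sort (ds_fun S) -> R) :
  is_stratifold S -> scalar chi -> {morph chi : f g / f * g} -> chi 1 = 1 ->
  exists x, forall f, chi f = f x.
Proof.
move=> sS chiL chiM chi1; apply: contrapT => nchi.
have chiD f g : chi (f + g) = chi f + chi g.
  by rewrite -[f in LHS]scale1r chiL mul1r.
have chi0 : chi 0 = 0 by apply: (addrI (chi 0)); rewrite -chiD !addr0.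
have chiZ a f : chi (a *: f) = a * chi f by rewrite -[a *: f in LHS]addr0 chiL chi0 addr0.
have chiB f g : chi (f - g) = chi f - chi g.
  by rewrite -scaleN1r chiD chiZ mulN1r.
(* If the whole kernel vanished at [x], the kernel element [f - chi f *: 1] would give [chi f = f x]
   for every [f]. *)
have sep x : exists2 g, chi g = 0 & g x != 0.
  apply: contrapT => nsep; apply: nchi; exists x => f.
  apply/eqP; rewrite eq_sym -subr_eq0; apply: contrapT => fx; apply: nsep.
  exists (f - chi f *: (1 : fun_sort _)); first by rewrite chiB chiZ chi1 mulr1 subrr.
  change (f x - chi f * 1 != 0); rewrite mulr1; exact/negP.
have [f0 Sf0 pf] := proper_fun sS; pose f := mk_fun Sf0.
(* The bound is a natural number above [|chi f|], so [K] contains the level set of [f] at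
   [chi f]. *)
have [K cK fK] := pf (Num.bound `|chi f|).
pose P (A : set S) := exists g, [/\ chi g = 0, forall y, 0 <= g y
  & forall y, A y -> 0 < g y].
have [g [g0 gge gK]] : P K.
  apply: (compact_union_ind (P := P)) cK.
  - by exists 0; split.
  - by move=> A B AB [g [? ? gB]]; exists g; split=> // y /AB/gB.
  - move=> A B [g [g0 gge gA]] [h [h0 hge hB]]; exists (g + h); split.
    + by rewrite chiD g0 h0 addr0.
    + by move=> y; change (0 <= g y + h y); exact: addr_ge0.
    + by move=> y yAB; change (0 < g y + h y); case: yAB => [/gA gy|/hB hy];
        [exact: ltr_wpDr|exact: ltr_wpDl].
  - move=> x _; have [g g0 gx] := sep x.
    exists [set y | g y != 0].
      exact: (cvgr_neq0 (g x) (ds_cont (fun_valP g) (x := x))).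
    exists (g * g); split.
    + by rewrite chiM g0 mulr0.
    + by move=> y; change (0 <= g y * g y); rewrite -expr2 sqr_ge0.
    + move=> y gy; change (0 < g y * g y).
      by rewrite lt_neqAle eq_sym mulf_neq0 //= -expr2 sqr_ge0.
pose c := chi f; pose d := f - c *: (1 : fun_sort _).
pose h := g + d * d.
have h0 x : h x != 0.
  change (g x + (f x - c * 1) * (f x - c * 1) != 0).
  rewrite mulr1 -expr2 lt0r_neq0 //.
  have [fx|fx] := eqVneq (f x) c; last first.
    by apply: ltr_wpDl => //; rewrite exprn_even_gt0 //= subr_eq0.
  apply: ltr_wpDr; first exact: sqr_ge0.
  apply: gK; apply: fK; change (f x < (Num.bound `|chi f|)%:R); rewrite fx.
  exact: le_lt_trans (ler_norm _) (archi_boundP (normr_ge0 _)).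
have Sk := stratifold_funV sS (fun_valP h) h0.
have : h * mk_fun Sk = 1.
  apply: val_inj; apply/funext => x; change (h x * (h x)^-1 = 1).
  by rewrite mulfV.
move/(congr1 chi); rewrite chiM chi1 chiD chiM chiB chiZ chi1 g0 mulr1 subrr.
by rewrite mulr0 addr0 mul0r => /esym/eqP; rewrite oner_eq0.
Qed.

(** * Faithfulness and fullness *)

(** Points are closed, so for distinct points a bump at [x] can be supported off [y]. *)
Lemma stratifold_fun_sep (R : realType) (S : diffspace R) (x y : S) :
  is_stratifold S -> (forall f, ds_fun S f -> f x = f y) -> x = y.
Proof.
move=> sS xy; apply: contrapT => nxy.
have oU : open (~` [set y]).
  apply: closed_openC; apply: accessible_closed_set1.
  exact/hausdorff_accessible/sf_hausdorff.
have [rho [Cr _ rx sr]] := sf_bump sS oU nxy.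
by apply: (sr y) => //; apply: subset_closure => /=; rewrite -xy.
Qed.

Lemma pullback_alg_inj (R : realType) (S S' : diffspace R) :
  is_stratifold S' -> injective (@pullback_alg R S S').
Proof.
move=> sS' phi psi epp; apply: diff_hom_eq => x.
apply: (stratifold_fun_sep sS') => f Sf.
pose ev (a : alg_hom (fun_alg (ds_fun S')) (fun_alg (ds_fun S))) :=
  fun_val (a (mk_fun Sf)) x.
exact: (congr1 ev epp).
Qed.

Lemma pullback_alg_surj (R : realType) (S S' : diffspace R)
    (alpha : alg_hom (fun_alg (ds_fun S')) (fun_alg (ds_fun S))) :
  is_stratifold S' -> exists phi : diff_hom S S', pullback_alg phi = alpha.
Proof.
move=> sS'.
pose a (g : fun_sort (ds_fun S')) : fun_sort (ds_fun S) := alpha g.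
have /choice[phi phiE] (x : S) : exists y : S', forall g, a g x = g y.
  apply: (character_eval (chi := fun g => a g x)) => //.
  - by move=> r f g; rewrite /a (alg_homD alpha (r *: f) g) (alg_homZ alpha r f).
  - by move=> f g; rewrite /a (alg_homM alpha f g).
  - by rewrite /a (alg_hom1 alpha).
have phi_comp f (Sf : ds_fun S' f) : f \o phi = a (mk_fun Sf).
  by apply/funext => x; rewrite phiE.
have phi_fun f : ds_fun S' f -> ds_fun S (f \o phi).
  by move=> Sf; rewrite (phi_comp _ Sf); exact: fun_valP.
have phi_cont : continuous phi.
  (* For a bump [rho] at [phi x] supported in [U], the composite [rho \o phi] is in the algebra of
     [S], hence continuous, and [phi] maps its nonvanishing locus into [U]. *)
  move=> x V; rewrite /= nbhsE => -[U [oU Ux] UV].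
  have [rho [Sr _ rx sr]] := sf_bump sS' oU Ux.
  apply: filterS (cvgr_neq0 (rho (phi x)) (ds_cont (phi_fun _ Sr) (x := x)) rx).
  by move=> y ry; apply: UV; apply: sr; exact: subset_closure.
exists (DiffHom phi_cont phi_fun); apply: alg_hom_eq => g; apply: val_inj.
by apply/funext => x; exact/esym/phiE.
Qed.

Theorem theorem1p1 (R : realType) : fully_faithful (function_functor R).
Proof.
move=> [S sS] [S' sS']; rewrite -setTT_bijective; split=> //.
  by move=> phi psi _ _; exact: pullback_alg_inj.
move=> alpha _; have [phi <-] := pullback_alg_surj alpha sS'.
by exists phi.
Qed.
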